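(* Let $E$ be a functor and $M$ a monad on the category of types, and let $\mathrm{op}$ be an $E$-operation for $M$. Assume that $M$ satisfies the following naturality hypothesis: for every type $A$, every $m : \forall B,\ (A \to M\,B) \to M\,B$, all types $A_1, B$ and every function $h : A_1 \to B$, $$ (M\,\#\,h) \circ m_{A_1} = m_B \circ \big(f \mapsto (M\,\#\,h)\circ f\big) $$ (as functions $(A\to M\,A_1)\to M\,B$). Let $t$ be a functorial monad transformer. Define the following natural transformations: - $\mathrm{op1} := \mathrm{Hmap}_t(\mathrm{from}) : t(\mathrm{codensityT}\,M) \leadsto t\,M$; - $\mathrm{op2}$ := the algebraic lifting of the $E$-operation $\psi(\kappa)$ for $\mathrm{codensityT}\,M$ along the monad morphism $\mathrm{Lift}_t(\mathrm{codensityT}\,M)$, i.e. the $E$-operation for $t(\mathrm{codensityT}\,M)$ with components $$\mathrm{op2}_X = \mathrm{Join}^{N}_X \circ \mathrm{Lift}_t(\mathrm{codensityT}\,M)_{N X} \circ \psi(\kappa)_{N X} \circ \big(E\,\#\,\mathrm{Ret}^{\mathrm{codensityT}\,M}_{N X}\big),\quad N = t(\mathrm{codensityT}\,M);$$ - $\mathrm{op3} : E \circ t\,M \leadsto E \circ t(\mathrm{codensityT}\,M)$ with components $\mathrm{op3}_X = E\,\#\,\big(\mathrm{Hmap}_t(\mathrm{Lift}_{\mathrm{codensityT}}\,M)\big)_X$. Then the $E$-operation $\mathrm{op1}\circ\mathrm{op2}\circ\mathrm{op3}$ (vertical composition) for $t\,M$ is a lifting of $\mathrm{op}$ along $\mathrm{Lift}_t\,M$,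 i.e. for every type $X$, $$ (\mathrm{Lift}_t\,M)_X \circ \mathrm{op}_X = \mathrm{op1}_X \circ \mathrm{op2}_X \circ \mathrm{op3}_X \circ \big(E\,\#\,(\mathrm{Lift}_t\,M)_X\big). $$
   Context: Setting: types live in a universe of types (taken impredicative, so that types quantifying over all types, like $\forall B, \dots$, are again types), with functional extensionality; functors, natural transformations and monads are endo-ones on this category of types. $F\,\#\,f$ denotes the action of functor $F$ on a function $f$; $\circ$ is composition; $F \leadsto G$ denotes natural transformations. For a monad $M$, $\mathrm{Ret}^M : \mathrm{Id}\leadsto M$ and $\mathrm{Join}^M : M\circ M \leadsto M$. An $E$-operation for a monad $M$ (for a functor $E$) is a natural transformation $E\circ M \leadsto M$. A monad morphism $e$ from $M$ to $N$ is a family $e_A : M\,A \to N\,A$ with $e_A\circ\mathrm{Ret}^M_A=\mathrm{Ret}^N_A$ and $e_B(m \gg\!= f) = e_A(m) \gg\!= (e_B\circ f)$; it is automatically natural. Given an $E$-operation $\mathrm{op}$ for $M$ and a monad morphism $e : M\to N$, an $E$-operation $\mathrm{op}'$ for $N$ is a lifting of $\mathrm{op}$ along $e$ if $e_X\circ\mathrm{op}_X = \mathrm{op}'_X\circ(E\,\#\,e_X)$ for all $X$. For a natural transformation $n : E\leadsto N$ to a monad $N$, $\psi(n)$ is the $E$-operation for $N$ with components $\psi(n)_X = \mathrm{Join}^N_X\circ n_{N X}$. Codensity monad transformer: for a monad $M$, $\mathrm{codensityT}\,M$ is the monad with $(\mathrm{codensityT}\,M)\,A = \forall B,\ (A\to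 M\,B)\to M\,B$, unit $\mathrm{ret}(a) = \lambda B\,k.\ k\,a$, bind $m \gg\!= f = \lambda C\,k.\ m\,C\,(\lambda a.\ f\,a\,C\,k)$, and monad morphism $\mathrm{Lift}_{\mathrm{codensityT}}\,M : M \to \mathrm{codensityT}\,M$ given by $m \mapsto \lambda B\,k.\ m \gg\!= k$. The map $\mathrm{from} : \mathrm{codensityT}\,M \leadsto M$ has components $\mathrm{from}_A(c) = c\,A\,\mathrm{Ret}^M_A$ (it is natural under the naturality hypothesis on $M$ stated in the claim). The natural transformation $\kappa : E \leadsto \mathrm{codensityT}\,M$ has components $\kappa_A(s) = \lambda B\,(k : A\to M\,B).\ \mathrm{op}_B((E\,\#\,k)\,s)$ for $s : E\,A$. A monad transformer $t$ assigns to each monad $M$ a monad $t\,M$ and a monad morphism $\mathrm{Lift}_t\,M : M \to t\,M$. It is functorial if it is moreover equipped with $\mathrm{Hmap}_t$ assigning to every natural transformation $n : M\leadsto N$ between monads a natural transformation $\mathrm{Hmap}_t(n) : t\,M \leadsto t\,N$ such that (1) $\mathrm{Hmap}_t(n)$ is a monad morphism whenever $n$ is, (2) $\mathrm{Hmap}_t$ preserves identities and vertical composition, and (3) $\mathrm{Hmap}_t(n)_X\circ(\mathrm{Lift}_t\,M)_X = (\mathrm{Lift}_t\,N)_X\circ n_X$ for all $n : M\leadsto N$ and all $X$. *)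

(* Defs.v *)
From Stdlib Require Import FunctionalExtensionality.
From mathcomp Require Import ssreflect ssrfun.

Set Implicit Arguments.
Unset Strict Implicit.
Unset Printing Implicit Defensive.

Declare Scope monad_scope.
Delimit Scope monad_scope with monad.
Local Open Scope monad_scope.

(* An impredicative universe of types, à la Tarski.  [pi] is the impredicative
   product rule: a product of types over an index type of any size (the whole
   universe included) is again a type.  Its code decodes to the full dependent
   product, up to the bijection [lam]/[app].  With the option
   -impredicative-set, [ty := Set] with [el] the identity is an instance. *)
Record universe := Universe {
  ty :> Type;
  el : ty -> Type;
  pi : forall I : Type, (I -> ty) -> ty;
  lam : forall (I : Type) (F : I -> ty), (forall i, el (F i)) -> el (pi F);
  app : forall (I : Type) (F : I -> ty), el (pi F) -> forall i, el (F i);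
  lamK : forall (I : Type) (F : I -> ty), cancel (@lam I F) (@app I F);
  appK : forall (I : Type) (F : I -> ty), cancel (@app I F) (@lam I F)
}.
Coercion el : ty >-> Sortclass.
Arguments pi {u I} F.
Arguments lam {u I F} f.
Arguments app {u I F} c i.

(* Without extra axioms, the sort [Prop] is an instance inside plain Rocq. *)
Definition prop_universe : universe :=
  @Universe Prop (fun P => P) (fun I F => forall i, F i)
    (fun I F f => f) (fun I F c => c) (fun I F f => erefl) (fun I F c => erefl).

(* In this category of types, the morphisms from [A] to [B] are all the
   functions [A -> B]. *)
Record functor (U : universe) := Functor {
  fobj :> U -> U;
  fmap : forall A B : U, (A -> B) -> fobj A -> fobj B;
  fmap_id : forall A : U, fmap (@id A) = @id (fobj A);
  fmap_comp : forall (A B C : U) (g : B -> C) (h : A -> B),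
    fmap (g \o h) = fmap g \o fmap h
}.
Arguments fmap {U} f [A B] h x.
Notation "F # h" := (fmap F h) (at level 11, no associativity) : monad_scope.

Section functors.
Variable U : universe.

Definition functor_id : functor U :=
  @Functor U id (fun A B h => h) (fun A => erefl) (fun A B C g h => erefl).

Variables F G : functor U.

Lemma fcomp_id (A : U) : F # (G # @id A) = @id (F (G A)).
Proof. by rewrite fmap_id fmap_id. Qed.

Lemma fcomp_comp (A B C : U) (g : B -> C) (h : A -> B) :
  F # (G # (g \o h)) = (F # (G # g)) \o (F # (G # h)).
Proof. by rewrite fmap_comp fmap_comp. Qed.

Definition functor_comp : functor U :=
  @Functor U (fun A => F (G A)) (fun A B h => F # (G # h)) fcomp_id fcomp_comp.

End functors.
Arguments functor_id {U}.
Notation "F \O G" := (functor_comp F G)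
  (at level 50, left associativity) : monad_scope.

Record nattrans (U : universe) (F G : functor U) := NatTrans {
  ncomp :> forall A : U, F A -> G A;
  natural : forall (A B : U) (h : A -> B),
    (G # h) \o @ncomp A = @ncomp B \o (F # h)
}.
Arguments ncomp {U F G} n A _ : rename.
Arguments NatTrans {U F G} ncomp natural.
Notation "F ~> G" := (nattrans F G) (at level 51, no associativity) : monad_scope.

Section nattrans_operations.
Variable U : universe.

Definition nid (F : functor U) : F ~> F :=
  NatTrans (fun A => @id (F A)) (fun A B h => erefl).

Lemma vcomp_natural (F G H : functor U) (n : G ~> H) (m : F ~> G)
    (A B : U) (h : A -> B) :
  (H # h) \o (n A \o m A) = (n B \o m B) \o (F # h).
Proof.
by rewrite [LHS](_ : _ = ((H # h) \o n A) \o m A) // natural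
  [LHS](_ : _ = n B \o ((G # h) \o m A)) // natural.
Qed.

Definition vcomp (F G H : functor U) (n : G ~> H) (m : F ~> G) : F ~> H :=
  NatTrans (fun A => n A \o m A) (vcomp_natural n m).

Lemma whisker_natural (E F G : functor U) (n : F ~> G) (A B : U) (h : A -> B) :
  ((E \O G) # h) \o (E # n A) = (E # n B) \o ((E \O F) # h).
Proof. by rewrite /= -!fmap_comp natural. Qed.

Definition whisker (E F G : functor U) (n : F ~> G) : E \O F ~> E \O G :=
  @NatTrans U (E \O F) (E \O G) (fun A => E # n A) (whisker_natural E n).

End nattrans_operations.
Notation "n \v m" := (vcomp n m) (at level 50, left associativity) : monad_scope.

Record monad (U : universe) := Monad {
  mfunctor :> functor U;
  Ret : functor_id ~> mfunctor;
  Join : mfunctor \O mfunctor ~> mfunctor;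
  joinRet : forall A : U, Join A \o Ret (mfunctor A) = id;
  joinMRet : forall A : U, Join A \o (mfunctor # Ret A) = id;
  joinA : forall A : U, Join A \o (mfunctor # Join A) = Join A \o Join (mfunctor A)
}.
Arguments Ret {U} m.
Arguments Join {U} m.

Definition bind (U : universe) (M : monad U) (A B : U) (m : M A) (f : A -> M B) :
  M B := Join M B ((M # f) m).
Notation "m >>= f" := (bind m f) (at level 49, left associativity) : monad_scope.

Section bind_theory.
Variables (U : universe) (M : monad U).

Lemma bind_ret (A B : U) (a : A) (f : A -> M B) : Ret M A a >>= f = f a.
Proof.
rewrite /bind; have /= -> := equal_f (natural (Ret M) f) a.
exact: (equal_f (joinRet M B) (f a)).
Qed.

Lemma ret_bind (A : U) (m : M A) : m >>= Ret M A = m.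
Proof. exact: (equal_f (joinMRet M A) m). Qed.

Lemma bindA (A B C : U) (m : M A) (f : A -> M B) (g : B -> M C) :
  m >>= f >>= g = m >>= (fun a => f a >>= g).
Proof.
rewrite /bind; have /= -> := equal_f (natural (Join M) g) ((M # f) m).
have /= <- := equal_f (joinA M C) ((M # (M # g)) ((M # f) m)).
congr (Join M C _).
rewrite -[LHS]/((M # Join M C \o M # (M # g) \o M # f) m).
by rewrite -!fmap_comp.
Qed.

Lemma fmap_bind (A B : U) (h : A -> B) (m : M A) :
  (M # h) m = m >>= (Ret M B \o h).
Proof.
rewrite /bind fmap_comp /=.
by rewrite -[RHS]/((Join M B \o M # Ret M B) ((M # h) m)) joinMRet.
Qed.

End bind_theory.

Section monad_of_ret_bind.
Variables (U : universe) (T : U -> U).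
Variable ret : forall A : U, A -> T A.
Variable bnd : forall A B : U, T A -> (A -> T B) -> T B.
Hypothesis bnd_ret : forall (A B : U) (a : A) (f : A -> T B),
  bnd (ret a) f = f a.
Hypothesis ret_bnd : forall (A : U) (m : T A), bnd m (@ret A) = m.
Hypothesis bndA : forall (A B C : U) (m : T A) (f : A -> T B) (g : B -> T C),
  bnd (bnd m f) g = bnd m (fun a => bnd (f a) g).

Let map (A B : U) (h : A -> B) (m : T A) : T B := bnd m (@ret B \o h).

Let map_id (A : U) : map (@id A) = id.
Proof. by apply: functional_extensionality => m; exact: ret_bnd. Qed.

Let map_comp (A B C : U) (g : B -> C) (h : A -> B) :
  map (g \o h) = map g \o map h.
Proof.
apply: functional_extensionality => m; rewrite /map /= bndA.
by congr bnd; apply: functional_extensionality => a /=; rewrite bnd_ret.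
Qed.

Definition functor_of_ret_bind : functor U := Functor map_id map_comp.
Let F := functor_of_ret_bind.

Let ret_natural (A B : U) (h : A -> B) :
  (F # h) \o @ret A = @ret B \o (functor_id # h).
Proof. by apply: functional_extensionality => a; exact: bnd_ret. Qed.

Definition ret_of_ret_bind : functor_id ~> F := @NatTrans U functor_id F ret ret_natural.

Let join (A : U) (m : T (T A)) : T A := bnd m id.

Let join_natural (A B : U) (h : A -> B) :
  (F # h) \o @join A = @join B \o ((F \O F) # h).
Proof.
apply: functional_extensionality => m; rewrite /= /join /map !bndA.
by congr bnd; apply: functional_extensionality => a /=; rewrite bnd_ret.
Qed.

Definition join_of_ret_bind : F \O F ~> F := @NatTrans U (F \O F) F join join_natural.

Let joinRet' (A : U) : @join A \o @ret (T A) = id.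
Proof. by apply: functional_extensionality => m; exact: bnd_ret. Qed.

Let joinMRet' (A : U) : @join A \o (F # @ret A) = id.
Proof.
apply: functional_extensionality => m; rewrite /= /join /map bndA -[RHS]ret_bnd.
by congr bnd; apply: functional_extensionality => a /=; rewrite bnd_ret.
Qed.

Let joinA' (A : U) : @join A \o (F # @join A) = @join A \o @join (T A).
Proof.
apply: functional_extensionality => m; rewrite /= /join /map !bndA.
by congr bnd; apply: functional_extensionality => a /=; rewrite bnd_ret.
Qed.

Definition monad_of_ret_bind : monad U :=
  @Monad U F ret_of_ret_bind join_of_ret_bind joinRet' joinMRet' joinA'.

Lemma bind_of_ret_bindE (A B : U) (m : T A) (f : A -> T B) :
  @bind U monad_of_ret_bind A B m f = bnd m f.
Proof.
rewrite /bind /= /join /map bndA.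
by congr bnd; apply: functional_extensionality => a /=; rewrite bnd_ret.
Qed.

End monad_of_ret_bind.

Definition is_monadm (U : universe) (M N : monad U)
    (e : forall A : U, M A -> N A) : Prop :=
  (forall A : U, e A \o Ret M A = Ret N A) /\
  (forall (A B : U) (m : M A) (f : A -> M B), e B (m >>= f) = e A m >>= (e B \o f)).

Record monadm (U : universe) (M N : monad U) := MonadM {
  mcomp : forall A : U, M A -> N A;
  mcompP : is_monadm mcomp
}.

Lemma monadm_natural (U : universe) (M N : monad U) (e : monadm M N)
    (A B : U) (h : A -> B) :
  (N # h) \o mcomp e (A := A) = mcomp e (A := B) \o (M # h).
Proof.
have [eret ebind] := mcompP e.
apply: functional_extensionality => m /=; rewrite !fmap_bind ebind.
by congr bind; apply: functional_extensionality => a /=; rewrite -eret.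
Qed.

Definition nattrans_of_monadm (U : universe) (M N : monad U) (e : monadm M N) :
  M ~> N := NatTrans (mcomp e) (monadm_natural e).
Coercion nattrans_of_monadm : monadm >-> nattrans.

Section operations.
Variables (U : universe) (E : functor U).

Definition operation (M : monad U) := E \O M ~> M.

Definition is_lifting (M N : monad U) (op : operation M) (e : monadm M N)
    (op' : operation N) : Prop :=
  forall X : U, e X \o op X = op' X \o (E # e X).

Lemma psi_natural (N : monad U) (n : E ~> N) (A B : U) (h : A -> B) :
  (N # h) \o (Join N A \o n (N A)) = (Join N B \o n (N B)) \o ((E \O N) # h).
Proof.
rewrite [LHS](_ : _ = ((N # h) \o Join N A) \o n (N A)) // natural.
by rewrite [LHS](_ : _ = Join N B \o ((N # (N # h)) \o n (N A))) // natural.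
Qed.

Definition psi (N : monad U) (n : E ~> N) : operation N :=
  @NatTrans U (E \O N) N (fun X => Join N X \o n (N X)) (psi_natural n).

Lemma phi_natural (M : monad U) (op : operation M) (A B : U) (h : A -> B) :
  (M # h) \o (op A \o (E # Ret M A)) = (op B \o (E # Ret M B)) \o (E # h).
Proof.
rewrite [LHS](_ : _ = ((M # h) \o op A) \o (E # Ret M A)) // natural.
rewrite [LHS](_ : _ = op B \o ((E # (M # h)) \o (E # Ret M A))) //.
by rewrite -fmap_comp natural fmap_comp.
Qed.

Definition phi (M : monad U) (op : operation M) : E ~> M :=
  NatTrans (fun X => op X \o (E # Ret M X)) (phi_natural op).

(* The components are
   Join N X \o e (N X) \o op (N X) \o (E # Ret M (N X)); for an algebraic [op]
   this is the algebraic lifting of [op] along [e]. *)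
Definition alifting (M N : monad U) (op : operation M) (e : monadm M N) :
  operation N := psi (e \v phi op).

End operations.

Section codensity.
Variables (U : universe) (M : monad U).

(* The code of  forall B, (A -> M B) -> M B *)
Definition codensity_ty (A : U) : U :=
  pi (fun B : U => pi (fun _ : A -> M B => M B)).

(* [run] and [codense] are application and abstraction through the two nested
   products. *)
Definition run (A : U) (c : codensity_ty A) (B : U) (k : A -> M B) : M B :=
  app (app c B) k.

Definition codense (A : U) (c : forall B : U, (A -> M B) -> M B) :
  codensity_ty A := lam (fun B => lam (c B)).

Lemma codenseK (A : U) (c : forall B : U, (A -> M B) -> M B) :
  run (codense c) = c.
Proof.
apply: functional_extensionality_dep => B; apply: functional_extensionality => k.
by rewrite /run /codense !lamK.
Qed.

Lemma runK (A : U) (c : codensity_ty A) : codense (run c) = c.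
Proof.
rewrite -[RHS]appK /codense; congr lam.
apply: functional_extensionality_dep => B; exact: appK.
Qed.

Definition codensity_ret (A : U) (a : A) : codensity_ty A :=
  codense (fun B k => k a).

Definition codensity_bind (A B : U) (m : codensity_ty A)
    (f : A -> codensity_ty B) : codensity_ty B :=
  codense (fun C k => run m (fun a => run (f a) k)).

Lemma codensity_bind_ret (A B : U) (a : A) (f : A -> codensity_ty B) :
  codensity_bind (codensity_ret a) f = f a.
Proof. by rewrite /codensity_bind codenseK; exact: runK. Qed.

Lemma codensity_ret_bind (A : U) (m : codensity_ty A) :
  codensity_bind m (@codensity_ret A) = m.
Proof.
rewrite -[RHS]runK; congr codense.
apply: functional_extensionality_dep => B; apply: functional_extensionality => k.
by congr run; apply: functional_extensionality => a; rewrite codenseK.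
Qed.

Lemma codensity_bindA (A B C : U) (m : codensity_ty A)
    (f : A -> codensity_ty B) (g : B -> codensity_ty C) :
  codensity_bind (codensity_bind m f) g =
  codensity_bind m (fun a => codensity_bind (f a) g).
Proof.
congr codense.
apply: functional_extensionality_dep => D; apply: functional_extensionality => k.
rewrite codenseK; congr run.
by apply: functional_extensionality => a; rewrite codenseK.
Qed.

Definition codensityT : monad U :=
  monad_of_ret_bind codensity_bind_ret codensity_ret_bind codensity_bindA.

Definition codensity_lift (A : U) (m : M A) : codensityT A :=
  codense (fun B k => m >>= k).

Lemma codensity_lift_is_monadm : is_monadm codensity_lift.
Proof.
split=> [A|A B m f].
  apply: functional_extensionality => a; congr codense.
  apply: functional_extensionality_dep => B.
  by apply: functional_extensionality => k; rewrite bind_ret.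
rewrite bind_of_ret_bindE; congr codense.
apply: functional_extensionality_dep => C; apply: functional_extensionality => k.
rewrite codenseK bindA; congr bind.
by apply: functional_extensionality => a /=; rewrite codenseK.
Qed.

Definition Lift_codensityT : monadm M codensityT :=
  MonadM codensity_lift_is_monadm.

Definition codensity_naturality : Prop :=
  forall (A : U) (m : forall B : U, (A -> M B) -> M B)
         (A1 B : U) (h : A1 -> B),
    (M # h) \o m A1 = m B \o (fun f : A -> M A1 => (M # h) \o f).

Definition from_component (A : U) (c : codensityT A) : M A := run c (Ret M A).

Lemma from_natural (nat_M : codensity_naturality) (A B : U) (h : A -> B) :
  (M # h) \o @from_component A = @from_component B \o (codensityT # h).
Proof.
apply: functional_extensionality => c; rewrite /= /from_component codenseK.
rewrite -[LHS]/((M # h \o @run A c A) (Ret M A)) nat_M /=.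
congr run; apply: functional_extensionality => a /=; rewrite codenseK.
exact: (equal_f (natural (Ret M) h) a).
Qed.

Definition from (nat_M : codensity_naturality) : codensityT ~> M :=
  NatTrans from_component (from_natural nat_M).

Variables (E : functor U) (op : operation E M).

Definition kappa_component (A : U) (s : E A) : codensityT A :=
  codense (fun (B : U) (k : A -> M B) => op B ((E # k) s)).

Lemma kappa_natural (A B : U) (h : A -> B) :
  (codensityT # h) \o @kappa_component A = @kappa_component B \o (E # h).
Proof.
apply: functional_extensionality => s; congr codense.
apply: functional_extensionality_dep => C; apply: functional_extensionality => k.
rewrite codenseK -[in RHS]/((E # k \o E # h) s) -fmap_comp.
congr (op C ((E # _) s)).
by apply: functional_extensionality => a /=; rewrite codenseK.
Qed.

Definition kappa : E ~> codensityT := NatTrans kappa_component kappa_natural.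

End codensity.

Record monad_transformer (U : universe) := MonadTransformer {
  tmonad :> monad U -> monad U;
  Lift : forall M : monad U, monadm M (tmonad M)
}.
Arguments Lift {U} t M : rename.

(* [Hmap] acts on all natural transformations between (the functors underlying)
   two monads, not only on monad morphisms. *)
Record functorial_monad_transformer (U : universe) := FMT {
  transformer :> monad_transformer U;
  Hmap : forall M N : monad U, (M ~> N) -> (transformer M ~> transformer N);
  Hmap_monadm : forall (M N : monad U) (n : M ~> N),
    is_monadm n -> is_monadm (Hmap n);
  Hmap_id : forall M : monad U, Hmap (nid M) = nid (transformer M);
  Hmap_vcomp : forall (M N P : monad U) (n : N ~> P) (m : M ~> N),
    Hmap (n \v m) = Hmap n \v Hmap m;
  Hmap_Lift : forall (M N : monad U) (n : M ~> N) (X : U),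
    Hmap n X \o Lift transformer M X = Lift transformer N X \o n X
}.
Arguments Hmap {U} t {M N} n : rename.

(* Main.v *)
(* The operation [psi (kappa op)] is recovered from its image under [phi], so its
   algebraic lifting really lifts it along [Lift t (codensityT M)].  Together
   with the compatibility of [Hmap t] with [Lift t], this reduces the claim to
   [from \v psi (kappa op)] after [E # Lift_codensityT M] being [op], which holds
   because [from] turns [psi (kappa op)] into [op] after [E # from] and retracts
   [Lift_codensityT M]. *)
From Stdlib Require Import FunctionalExtensionality.
From mathcomp Require Import ssreflect ssrfun.
Require Import Defs.
Local Open Scope monad_scope.

(** [Join] is [bind] at the identity; naturality of [e] then reorders the two layers. *)
Lemma monadm_join (U : universe) (M N : monad U) (e : monadm M N) (A : U)
    (m : M (M A)) :
  e A (Join M A m) = Join N A (e (N A) ((M # e A) m)).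
Proof.
have [_ ebind] := mcompP e.
have /= := ebind _ _ m id; rewrite /bind fmap_id /= => ->.
by have /= -> := equal_f (natural e (e A)) m.
Qed.

(** Naturality of [n] at [Ret] leaves [Join] after [N # Ret], a monad law. *)
Lemma phi_psi (U : universe) (E : functor U) (N : monad U) (n : E ~> N)
    (A : U) (s : E A) :
  phi (psi n) A s = n A s.
Proof.
rewrite /=; have /= <- := equal_f (natural n (Ret N A)) s.
exact: (equal_f (joinMRet N A) (n A s)).
Qed.

Lemma alifting_psi_lifting (U : universe) (E : functor U) (M N : monad U)
    (n : E ~> M) (e : monadm M N) :
  is_lifting (psi n) e (alifting (psi n) e).
Proof.
move=> X; apply: functional_extensionality => s.
rewrite [LHS]monadm_join; have /= -> := equal_f (natural n (e X)) s.
exact/esym/(congr1 (fun x => Join N X (e (N X) x)))/phi_psi.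
Qed.

Lemma from_lift (U : universe) (M : monad U) (A : U) :
  @from_component U M A \o Lift_codensityT M A = id.
Proof.
apply: functional_extensionality => m.
rewrite /= /from_component codenseK; exact: ret_bind.
Qed.

(** Running the join at [Ret M A] hands [kappa] the continuation [fun c => run c (Ret M A)], which
    is [from_component]. *)
Lemma from_psi_kappa (U : universe) (E : functor U) (M : monad U)
    (op : operation E M) (A : U) (s : E (codensityT M A)) :
  from_component (psi (kappa op) A s) = op A ((E # @from_component U M A) s).
Proof. by rewrite /from_component /= codenseK codenseK. Qed.

Theorem theorem2 (U : universe) (E : functor U) (M : monad U)
    (op : operation E M) (nat_M : codensity_naturality M)
    (t : functorial_monad_transformer U) :
  let op1 : t (codensityT M) ~> t M := Hmap t (from nat_M) in
  let op2 : operation E (t (codensityT M)) :=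
    alifting (psi (kappa op)) (Lift t (codensityT M)) in
  let op3 : E \O t M ~> E \O t (codensityT M) :=
    whisker E (Hmap t (Lift_codensityT M)) in
  is_lifting op (Lift t M) (op1 \v op2 \v op3).
Proof.
move=> op1 op2 op3 X; apply: functional_extensionality => s.
rewrite -[RHS]/(op1 X (op2 X (((E # Hmap t (Lift_codensityT M) X)
                               \o (E # Lift t M X)) s))).
(* Under [E], the lift through [t] now comes last, as the lifting property of [op2] requires. *)
rewrite -fmap_comp Hmap_Lift fmap_comp.
have /= <- := equal_f (@alifting_psi_lifting _ _ _ _ (kappa op)
  (Lift t (codensityT M)) X) ((E # Lift_codensityT M X) s).
have /= -> := equal_f (Hmap_Lift t (from nat_M) X)
  (psi (kappa op) X ((E # Lift_codensityT M X) s)).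
congr (Lift t M X _); rewrite from_psi_kappa.
have /= <- := equal_f (fmap_comp E (@from_component U M X)
  (Lift_codensityT M X)) s.
by rewrite from_lift fmap_id.
Qed.
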